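(* Let $P \subset l_\infty^n$ be a convex polyhedron such that $\mathrm{int}(P) \neq \emptyset$. Then the following are equivalent: (i) $P$ is injective. (ii) $\mathrm{T}_pP$ is injective for every $p \in \partial P$.
   Context: $l_\infty^n$ denotes $\mathbb{R}^n$ endowed with the metric induced by the maximum norm $\|\cdot\|_\infty$; subsets of $l_\infty^n$ carry the induced metric. A metric space $X$ is called injective if for any metric spaces $A,B$, any isometric embedding $i\colon A\to B$ and any $1$-Lipschitz (i.e. distance nonincreasing) map $f\colon A\to X$, there is a $1$-Lipschitz map $g\colon B\to X$ with $g\circ i=f$. A convex polyhedron in $\mathbb{R}^n$ is a finite intersection of closed half-spaces (with the empty intersection being $\mathbb{R}^n$). For a nonempty convex polyhedron $P\subset\mathbb{R}^n$ and $p\in P$, the tangent cone is $\mathrm{T}_pP := \bigcup_{m\in\mathbb{N}} \bigl(p+m(P-p)\bigr)$. $\mathrm{int}(P)$ and $\partial P$ are the topological interior and boundary of $P$ in $\mathbb{R}^n$. *)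

(* Defs.v *)
From HB Require Import structures.
From mathcomp Require Import all_boot all_order all_algebra.
From mathcomp Require Import all_classical all_reals all_analysis.

Set Implicit Arguments.
Unset Strict Implicit.
Unset Printing Implicit Defensive.

Import Order.TTheory GRing.Theory Num.Theory.
Import numFieldNormedType.Exports.

Local Open Scope classical_set_scope.
Local Open Scope ring_scope.

(* The library norm on matrices is the maximum of the absolute values of the
   entries (mx_normrE), so ['rV[R]_n] with the distance below is l_infty^n. *)
Section matrix_metric.
Variables (R : numFieldType) (m n : nat).

Let dist (x y : 'M[R]_(m, n)) : R := `|x - y|.

Let dist_ge0 x y : 0 <= dist x y.
Proof. exact: normr_ge0. Qed.

Let dist_positivity x y : dist x y = 0 -> x = y.
Proof. by move/normr0_eq0/eqP; rewrite subr_eq0 => /eqP. Qed.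

Let ballE x d : ball x d = [set y | dist x y < d].
Proof. by rewrite -ball_normE. Qed.

HB.instance Definition _ :=
  @PseudoMetric_isMetric.Build R 'M[R]_(m, n)
    dist dist_ge0 dist_positivity ballE.

Lemma mdist_mxE (x y : 'M[R]_(m, n)) : mdist x y = `|x - y|.
Proof. by []. Qed.

End matrix_metric.

Section induced_metric.
Variables (R : realType) (X : metricType R) (A : set X).

Let dist (x y : set_type A) : R := mdist (set_val x) (set_val y).

Let dist_ge0 x y : 0 <= dist x y.
Proof. exact: mdist_ge0. Qed.

Let dist_positivity x y : dist x y = 0 -> x = y.
Proof. by move/mdist_positivity => xy; apply: val_inj. Qed.

Let ballE x d : ball x d = [set y | dist x y < d].
Proof.
rewrite -[LHS](@initial_ballE R (set_type A) X set_val d x).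
by rewrite ballEmdist.
Qed.

HB.instance Definition _ :=
  @PseudoMetric_isMetric.Build R (set_type A)
    dist dist_ge0 dist_positivity ballE.

Lemma mdist_subE (x y : set_type A) :
  mdist x y = mdist (set_val x) (set_val y).
Proof. by []. Qed.

End induced_metric.

Definition isometric_embedding (R : realType) (A B : metricType R)
    (i : A -> B) : Prop :=
  forall x y, mdist (i x) (i y) = mdist x y.

Definition nonexpansive (R : realType) (A B : metricType R)
    (f : A -> B) : Prop :=
  forall x y, mdist (f x) (f y) <= mdist x y.

Definition injective_space (R : realType) (X : metricType R) : Prop :=
  forall (A B : metricType R) (i : A -> B) (f : A -> X),
    isometric_embedding i -> nonexpansive f ->
    exists g : B -> X, nonexpansive g /\ g \o i =1 f.

Definition boundary (T : topologicalType) (A : set T) : set T :=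
  closure A `\` A°.

Definition closed_halfspace (R : realType) (n : nat)
    (H : set 'rV[R]_n) : Prop :=
  exists (a : 'rV[R]_n) (b : R),
    a != 0 /\ H = [set x | \sum_(i < n) a 0 i * x 0 i <= b].

Definition convex_polyhedron (R : realType) (n : nat)
    (P : set 'rV[R]_n) : Prop :=
  exists (m : nat) (H : 'I_m -> set 'rV[R]_n),
    (forall k, closed_halfspace (H k)) /\ P = \bigcap_k H k.

Definition tangent_cone (R : realType) (n : nat)
    (P : set 'rV[R]_n) (p : 'rV[R]_n) : set 'rV[R]_n :=
  \bigcup_(m : nat) [set p + m%:R *: (x - p) | x in P].

(* Main.v *)
Require Import Defs.
From mathcomp Require Import all_boot all_order all_algebra.
From mathcomp Require Import all_classical all_reals all_analysis.
From mathcomp Require Import ring lra.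

Set Implicit Arguments.
Unset Strict Implicit.
Unset Printing Implicit Defensive.

Import Order.TTheory GRing.Theory Num.Theory.
Import numFieldNormedType.Exports.
Local Open Scope classical_set_scope.
Local Open Scope ring_scope.

(** The equivalence becomes elementary once injectivity is replaced by
hyperconvexity: a set [X] is hyperconvex when all balls of a family with
centers in [X], any two of which satisfy [mdist x y <= r + s], have a common
point in [X].  Hyperconvexity implies injectivity by extending maps one point
at a time ([hyperconvex_injective]).  Conversely, the whole space is
hyperconvex for the maximum norm, because balls are boxes and intervals of the
line that meet pairwise have a common point ([hyperconvex_setT]); an injective
subset is a 1-Lipschitz retract of the whole space and inherits the property
([injective_hyperconvex]).

From [P] to the tangent cone at [p]: the cone is the increasing union of the
homothetic copies [p + k (P - p)], each of which is hyperconvex.  Given a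
family of balls centered in the cone, keep only the balls whose centers lie in
the [k]-th copy; the common points of these form nonempty closed sets that
decrease with [k] and are bounded, so they share a point.  The point lies in
the cone because the cone of a polyhedron is closed: it is cut out by the
constraints active at [p] ([tangent_cone_solution_set]).

From the tangent cones to [P] (closed and convex): given balls with centers in
[P], let [t >= 0] be the least number such that the balls with radii increased
by [t] share a point [z] of [P]; it is attained by compactness.  The cone at
[z] contains [P] and is hyperconvex, so the original balls share a point [z']
of the cone.  For small [s > 0] the point [z + s (z' - z)] lies in [P], and by
convexity of the norm it lies in all balls with radii increased by
[(1 - s) t].  Minimality forces [t = 0].  At an interior point [z] the cone is
the whole space, so only the cones at boundary points matter. *)

(** * Hyperconvexity and injectivity *)

Definition hyperconvex (R : realType) (M : metricType R) (X : set M) : Prop :=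
  forall F : M -> R -> Prop,
    (forall x r, F x r -> X x) ->
    (forall x r y s, F x r -> F y s -> mdist x y <= r + s) ->
    exists2 z, X z & forall x r, F x r -> mdist x z <= r.

(** Zorn's lemma on the graphs of 1-Lipschitz partial maps from [B] to [X].  If
[b] is outside the domain of a maximal one, the balls around the values at [b']
of radius [mdist b b'] satisfy the hypothesis of hyperconvexity by the triangle
inequality, and a common point is an admissible value at [b]. *)
Lemma hyperconvex_injective (R : realType) (M : metricType R) (X : set M) :
  hyperconvex X -> injective_space (set_type X).
Proof.
move=> hX A B i f isoi nef.
(* The graph of [f] is added to [G] instead of being required inside [G], so
   that the empty chain needs no separate treatment. *)
pose graph (G : set (B * set_type X)) : set (B * set_type X) :=
  G `|` [set (i a, f a) | a in setT].
pose partial (G : set (B * set_type X)) :=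
  forall p q, graph G p -> graph G q -> mdist p.2 q.2 <= mdist p.1 q.1.
have [F Fpartial Ftotal|G [Gpartial Gmax]] := @Zorn_bigcup _ partial.
  have step p : graph (\bigcup_(S in F) S) p ->
      (exists2 S, F S & S p) \/ graph set0 p.
    by case=> [[S FS Sp]|fp]; [left; exists S | right; right].
  move=> p q /step[[S FS Sp]|[//|fp]] /step[[T FT Tq]|[//|fq]].
  - have [ST|TS] := Ftotal _ _ FS FT.
      by apply: (Fpartial _ FT); left => //; apply: ST.
    by apply: (Fpartial _ FS); left => //; apply: TS.
  - by apply: (Fpartial _ FS); [left|right].
  - by apply: (Fpartial _ FT); [right|left].
  - case: fp fq => a _ <- [b _ <-] /=.
    by rewrite isoi; apply: nef.
have total b : exists x, graph G (b, x).
  have [||z Xz zP] := hX (fun x r => exists p, [/\ graph G p,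
      x = set_val p.2 & r = mdist b p.1]).
  - by move=> _ _ [p [_ -> _]]; apply: set_valP.
  - move=> _ _ _ _ [p [Gp -> ->]] [q [Gq -> ->]].
    rewrite -mdist_subE; apply: le_trans (Gpartial _ _ Gp Gq) _.
    by rewrite (metric_sym b p.1); apply: metric_triangle.
  pose u : set_type X := SigSub (mem_set Xz).
  have du p : graph G p -> mdist p.2 u <= mdist p.1 b.
    move=> Gp; rewrite mdist_subE (metric_sym p.1).
    by apply: zP; exists p.
  exists u; left; apply: contrapT => GNbu.
  apply: (Gmax (G `|` [set (b, u)])).
    split; first by move=> p; left.
    by move=> /(_ (b, u)) => GG; apply: GNbu; apply: GG; right.
  have split p : graph (G `|` [set (b, u)]) p -> graph G p \/ p = (b, u).
    by case=> [[]|]; [left; left | right | left; right].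
  move=> p q /split[Gp|->] /split[Gq|->] /=.
  - exact: Gpartial.
  - exact: du.
  - by rewrite (metric_sym u) (metric_sym b); apply: du.
  - by rewrite !mdistxx.
have [g gP] := choice total.
exists g; split=> [b c|a]; first exact: Gpartial (gP b) (gP c).
(* Two values at the same point of [B] are at distance at most 0. *)
apply: mdist_positivity; apply/le_anti; rewrite mdist_ge0 andbT.
rewrite -(mdistxx (i a)).
by apply: (Gpartial _ _ (gP (i a)) (_ : graph G (i a, f a))); right; exists a.
Qed.

(** * Nested sequences of compact sets *)

(** Cantor's intersection theorem: a cluster point of a sequence of points
[u k] of [C k] lies in every [C k]. *)
Lemma nested_compact_nonempty (T : topologicalType) (C : nat -> set T) :
  compact (C 0%N) -> (forall k, closed (C k)) -> (forall k, C k !=set0) ->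
  (forall k l, (k <= l)%N -> C l `<=` C k) -> exists z, forall k, C k z.
Proof.
move=> cptC clC C0 decrC; have [u uC] := choice C0.
have near_C k : \forall l \near \oo, C k (u l).
  by near=> l; apply: (decrC k l _ _ (uC l)); near: l; exact: nbhs_infty_ge.
have [z [_ uz]] := cptC (u @ \oo) _ (near_C 0%N).
exists z => k; move: uz; rewrite clusterE => /(_ (C k) (near_C k)).
by rewrite -(closure_id (C k)).1.
Unshelve. all: by end_near. Qed.

(** * Hyperconvex subsets for the maximum norm *)

Section MaxNorm.
Context {R : realType} {n : nat}.
Implicit Types (P X : set 'rV[R]_n) (p x y z : 'rV[R]_n).

Lemma hyperconvexP X : hyperconvex X <-> forall F : 'rV[R]_n -> R -> Prop,
    (forall x r, F x r -> X x) ->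
    (forall x r y s, F x r -> F y s -> `|x - y| <= r + s) ->
    exists2 z, X z & forall x r, F x r -> `|x - z| <= r.
Proof. by []. Qed.

Lemma entry_le_norm x j : `|x 0 j| <= `|x|.
Proof.
rewrite [leRHS]mx_normrE.
exact: (le_bigmax 0 (fun ij : 'I_1 * 'I_n => `|x ij.1 ij.2|) (0, j)).
Qed.

Lemma norm_le_entries x r : 0 <= r -> (forall j, `|x 0 j| <= r) -> `|x| <= r.
Proof.
move=> r0 xr; rewrite [leLHS]mx_normrE.
apply/bigmax_leP; split=> // -[i j] _ /=.
by rewrite ord1.
Qed.

(** A ball is a product of intervals [x j - r, x j + r], so the coordinates can
be treated separately: pairwise, every left endpoint is at most every right
endpoint, and the supremum of the left endpoints lies in all the intervals. *)
Lemma hyperconvex_setT : hyperconvex [set: 'rV[R]_n].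
Proof.
apply/hyperconvexP => F _ Fmeet.
pose E j : set R := [set t | exists x r, F x r /\ t = x 0 j - r].
have Fmeetj j x r y s : F x r -> F y s -> y 0 j - s <= x 0 j + r.
  move=> Fx Fy; have := Fmeet _ _ _ _ Fx Fy.
  move=> /(le_trans (entry_le_norm _ j)); rewrite !mxE ler_distl => /andP[].
  lra.
exists (\row_j sup (E j)) => // x r Fx.
have r0 : 0 <= r by have := Fmeet _ _ _ _ Fx Fx; rewrite subrr normr0; lra.
apply: norm_le_entries => // j; rewrite !mxE ler_distl; apply/andP; split.
  suff : sup (E j) <= x 0 j + r by lra.
  apply: ge_sup; first by exists (x 0 j - r), x, r.
  by move=> _ [y [s [Fy ->]]]; apply: Fmeetj.
suff : x 0 j - r <= sup (E j) by lra.
apply: ub_le_sup; last by exists x, r.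
by exists (x 0 j + r) => _ [y [s [Fy ->]]]; apply: Fmeetj.
Qed.

(** Extending the identity of [X] along its inclusion gives a 1-Lipschitz
retraction of the whole space onto [X], which moves a common point of balls
centered in [X] to a common point in [X]. *)
Lemma injective_hyperconvex X :
  injective_space (set_type X) -> hyperconvex X.
Proof.
move=> injX; apply/hyperconvexP => F FX Fmeet.
have [//|//|g [neg gX]] :=
  injX (set_type X : metricType R) ('rV[R]_n : metricType R) set_val id.
have [//|z _ zF] := hyperconvex_setT _ Fmeet.
exists (set_val (g z)); first exact: set_valP.
move=> x r Fxr; apply: le_trans (zF _ _ Fxr).
pose u : set_type X := SigSub (mem_set (FX _ _ Fxr)).
have xu : set_val (g x) = x := congr1 set_val (gX u).
rewrite -[X in X - set_val _]xu; exact: (neg x z).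
Qed.

Lemma injective_hyperconvexP X :
  injective_space (set_type X) <-> hyperconvex X.
Proof.
by split; [exact: injective_hyperconvex | exact: hyperconvex_injective].
Qed.

Lemma nested_closed_ball_nonempty (C : nat -> set 'rV[R]_n) x r :
  (forall k, closed (C k)) -> (forall k, C k !=set0) ->
  (forall k l, (k <= l)%N -> C l `<=` C k) ->
  (forall z, C 0%N z -> `|x - z| <= r) -> exists z, forall k, C k z.
Proof.
move=> clC C0 decrC bndC; apply: nested_compact_nonempty => //.
apply: bounded_closed_compact => //.
rewrite /mkset/bounded_near; near=> M => z /bndC xz /=.
rewrite -[z](subKr x); apply: le_trans (ler_normB _ _) _.
apply: (@le_trans _ _ (`|x| + r)); first by rewrite lerD2l.
near: M; apply: nbhs_pinfty_ge; exact: num_real.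
Unshelve. all: by end_near. Qed.

(** * Tangent cones of convex sets *)

Definition convex P :=
  forall x y (s : R), P x -> P y -> 0 <= s <= 1 -> P (x + s *: (y - x)).

Definition common_points (F : 'rV[R]_n -> R -> Prop) : set 'rV[R]_n :=
  [set z | forall x r, F x r -> `|x - z| <= r].

Lemma closed_common_points F : closed (common_points F).
Proof.
rewrite (_ : common_points F = \bigcap_(q in [set q | F q.1 q.2])
    closed_ball_ Num.norm q.1 q.2).
  by apply: closed_bigI => q _; exact: closed_closed_ball_.
apply/seteqP; split=> z zF; first by move=> [x r] /zF.
by move=> x r Fxr; apply: (zF (x, r)).
Qed.

Definition homothety p (t : R) x : 'rV[R]_n := p + t *: (x - p).

Lemma hyperconvex_homothety p t X :
  0 < t -> hyperconvex X -> hyperconvex (homothety p t @` X).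
Proof.
move=> t0 /hyperconvexP hX; apply/hyperconvexP => F FX Fmeet.
have distE x y : `|homothety p t x - homothety p t y| = t * `|x - y|.
  rewrite /homothety opprD addrACA subrr add0r -scalerBr.
  by rewrite opprB addrA subrK normrZ gtr0_norm.
have [x r /FX[y Xy xy]|x r y s Fx Fy|z Xz zF] :=
    hX (fun y s => F (homothety p t y) (t * s)).
- suff -> : x = y by [].
  apply/eqP; rewrite -subr_eq0 -normr_eq0.
  rewrite -(mulrI_eq0 _ (lregP (lt0r_neq0 t0))) -distE xy.
  by rewrite subrr normr0.
- by have := Fmeet _ _ _ _ Fx Fy; rewrite !distE -mulrDr ler_pM2l.
exists (homothety p t z); first by exists z.
move=> x r Fxr; have [y Xy yx] := FX _ _ Fxr.
rewrite -yx distE mulrC -ler_pdivlMr//; apply: zF.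
by rewrite yx mulrC divfK// gt_eqF.
Qed.

Lemma tangent_coneP P p x : tangent_cone P p x <->
  exists m : nat, (homothety p m%:R @` P) x.
Proof. by split=> [[m _ Px]|[m Px]]; exists m. Qed.

(** For a convex set the copies [p + k (P - p)] whose union is the tangent cone
increase with [k]. *)
Lemma homothety_mono P p (k l : nat) : convex P -> P p -> (k <= l)%N ->
  homothety p k%:R @` P `<=` homothety p l%:R @` P.
Proof.
move=> cvxP Pp; case: l => [|l kl]; first by rewrite leqn0 => /eqP ->.
move=> _ [x Px <-]; have l0 : 0 < l.+1%:R :> R by rewrite ltr0n.
exists (p + (k%:R / l.+1%:R) *: (x - p)); last first.
  rewrite /homothety addrAC subrr add0r scalerA mulrCA divff ?mulr1//.
apply: cvxP => //; rewrite divr_ge0 ?ler0n//=.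
by rewrite ler_pdivrMr// mul1r ler_nat.
Qed.

(** Blowing up at [p]: hyperconvexity passes to the copies [p + k (P - p)] by
scaling, and to their union by compactness once the union is closed. *)
Lemma hyperconvex_tangent_cone P p :
  convex P -> P p -> closed (tangent_cone P p) ->
  hyperconvex P -> hyperconvex (tangent_cone P p).
Proof.
move=> cvxP Pp clT hP; apply/hyperconvexP => F FT Fmeet.
have Tp : tangent_cone P p p.
  by apply/tangent_coneP; exists 0%N, p; rewrite // /homothety scale0r addr0.
have [[x0 [r0 F0]]|F0] := pselect (exists x r, F x r); last first.
  by exists p => // x r Fxr; case: F0; exists x, r.
have /tangent_coneP[m0 Pm0] := FT _ _ F0.
(* The indices start at [m0] so that already [C 0] lies in the ball around
   [x0]; the successor makes the ratio of the homothety positive. *)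
pose Q k := homothety p (m0 + k).+1%:R @` P.
have QS k l : (k <= l)%N -> Q k `<=` Q l.
  by move=> kl; apply: homothety_mono => //; rewrite ltnS leq_add2l.
pose C k := tangent_cone P p `&`
  common_points (fun x r => F x r /\ Q k x).
have [||k l kl z [Tz zF]|z [_ zF]|z zC] := @nested_closed_ball_nonempty C x0 r0.
- move=> k; apply: closedI => //.
  exact: closed_common_points.
- move=> k.
  have [x r []//|x r y s [Fx _] [Fy _]|z Qz zF] :=
      (hyperconvexP _).1 (@hyperconvex_homothety p _ P (ltr0Sn _ (m0 + k)) hP)
        (fun x r => F x r /\ Q k x).
    exact: Fmeet.
  by exists z; split=> //; apply/tangent_coneP; exists (m0 + k).+1.
- by split=> // x r [Fx Qx]; apply: zF; split=> //; apply: QS Qx.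
- apply: zF; split=> //; apply: homothety_mono Pm0 => //.
  by rewrite addn0.
exists z => [|x r Fxr]; first by have [] := zC 0%N.
have /tangent_coneP[m Pm] := FT _ _ Fxr.
have [_] := zC m; apply; split=> //; apply: homothety_mono Pm => //.
by rewrite leqW// leq_addl.
Qed.

(** The local-to-global step: an optimal approximate common point [z] of the
balls would be improved by moving a little towards an exact common point in the
tangent cone at [z]. *)
Lemma hyperconvex_of_tangent_cones P :
  closed P -> convex P -> P !=set0 ->
  (forall p, P p -> hyperconvex (tangent_cone P p)) -> hyperconvex P.
Proof.
move=> clP cvxP [p0 Pp0] hT; apply/hyperconvexP => F FP Fmeet.
have [[x0 [r0 F0]]|F0] := pselect (exists x r, F x r); last first.
  by exists p0 => // x r Fxr; case: F0; exists x, r.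
pose S := [set t : R | 0 <= t /\
  exists2 z, P z & forall x r, F x r -> `|x - z| <= r + t].
have S0 : lbound S 0 by move=> t [].
have hasS : has_inf S.
  split; last by exists 0.
  exists r0; split; last by exists x0 => [|x r Fx]; [exact: FP F0|exact: Fmeet].
  by have := Fmeet _ _ _ _ F0 F0; rewrite subrr normr0; lra.
set t := inf S.
have t0 : 0 <= t by apply: lb_le_inf => //; case: hasS.
(* The infimum is attained. *)
pose C k := P `&` common_points
  (fun x r => exists2 s, F x s & r = s + t + k.+1%:R^-1).
have [||k l kl z [Pz zF]|z [_ zF]|z zC] :=
    @nested_closed_ball_nonempty C x0 (r0 + t + 1^-1).
- move=> k; apply: closedI => //.
  exact: closed_common_points.
- move=> k; have k0 : 0 < k.+1%:R^-1 :> R by rewrite invr_gt0 ltr0n.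
  have [s [_ [z Pz zF]] st] := inf_adherent k0 hasS.
  exists z; split=> // x _ [r Fxr ->].
  by apply: le_trans (zF _ _ Fxr) _; rewrite -addrA lerD2l ltW.
- split=> // x _ [r Fxr ->].
  apply: le_trans (zF _ _ (ex_intro2 _ _ r Fxr erefl)) _.
  by rewrite lerD2l lef_pV2 ?posrE ?ltr0n// ler_nat.
- by apply: zF; exists r0.
have Pz : P z by have [] := zC 0%N.
have zF x r : F x r -> `|x - z| <= r + t.
  move=> Fxr; apply/ler_addgt0Pr => e e0.
  have [k ke] : exists k : nat, k.+1%:R^-1 < e.
    have [k _ kP] := near_infty_natSinv_lt (PosNum e0).
    by exists k; exact: (kP k (leqnn k)).
  have [_ /(_ x _ (ex_intro2 _ _ r Fxr erefl))/le_trans] := zC k.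
  by apply; rewrite lerD2l ltW.
have [|//|z' /tangent_coneP[m [y Py yz']] z'F] :=
    (hyperconvexP _).1 (hT _ Pz) F.
  move=> x r /FP Px; apply/tangent_coneP; exists 1%N, x => //.
  by rewrite /homothety scale1r addrC subrK.
(* As [z' = z + m (y - z)] with [y] in [P], the point [z + s (z' - z)] lies on
   the segment from [z] to [y] as soon as [s * m <= 1]. *)
pose s : R := m.+1%:R^-1.
have s0 : 0 < s by rewrite invr_gt0 ltr0n.
have s1 : s <= 1 by rewrite invf_le1 ?ler1n// ltr0n.
have S1 : S ((1 - s) * t).
  split; first by rewrite mulr_ge0// subr_ge0.
  exists (homothety z s z').
    rewrite -yz' /homothety addrAC subrr add0r scalerA; apply: cvxP => //.
    rewrite mulr_ge0 ?ler0n ?(ltW s0)//=.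
    by rewrite mulrC ler_pdivrMr ?ltr0n// mul1r ler_nat.
  move=> x r Fxr.
  have -> : x - homothety z s z' = (1 - s) *: (x - z) + s *: (x - z').
    by rewrite /homothety; apply/rowP => j; rewrite !mxE; ring.
  apply: le_trans (ler_normD _ _) _; rewrite !normrZ (gtr0_norm s0).
  rewrite ger0_norm ?subr_ge0//.
  have h1 := zF _ _ Fxr; have := z'F _ _ Fxr => h2.
  have h3 : (1 - s) * `|x - z| <= (1 - s) * (r + t).
    by rewrite ler_wpM2l// subr_ge0.
  have h4 : s * `|x - z'| <= s * r by rewrite ler_wpM2l// ltW.
  lra.
have /= t1 := ge_inf hasS.2 S1; rewrite -/t in t1.
have t_le0 : t <= 0 by rewrite -(pmulr_rle0 _ s0); lra.
exists z => // x r /zF; lra.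
Qed.

Lemma tangent_cone_interior P p : P° p -> tangent_cone P p = [set: 'rV[R]_n].
Proof.
move=> /nbhs_ballP[e /= e0 eP]; apply/seteqP; split=> // x _.
apply/tangent_coneP.
pose m := (Num.bound (`|x - p| / e)).+1.
have m0 : 0 < m%:R :> R by rewrite ltr0n.
exists m, (p + m%:R^-1 *: (x - p)); last first.
  rewrite /homothety addrAC subrr add0r scalerA divff ?gt_eqF// scale1r.
  by rewrite addrC subrK.
apply: eP; rewrite -ball_normE /ball_/= opprD addrA subrr sub0r normrN normrZ.
rewrite gtr0_norm ?invr_gt0// mulrC ltr_pdivrMr// mulrC -ltr_pdivrMr//.
apply: lt_trans (archi_boundP _) _; first by rewrite divr_ge0// ltW.
by rewrite ltr_nat.
Qed.

(** * Polyhedra *)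

Definition dot (a x : 'rV[R]_n) : R := \sum_(i < n) a 0 i * x 0 i.

Lemma dot_homothety a p t x :
  dot a (homothety p t x) = dot a p + t * (dot a x - dot a p).
Proof.
rewrite /dot -sumrB big_distrr -big_split /=; apply: eq_bigr => i _.
rewrite !mxE; ring.
Qed.

Lemma dot_continuous a : continuous (dot a).
Proof.
have := @continuous_big R 'I_n +%R 0 xpredT (@add_continuous R)
  'rV[R]_n (index_enum _) (fun i x => a 0 i * x 0 i).
apply=> i _ x; apply: continuousM; first exact: cst_continuous.
exact: coord_continuous.
Qed.

(** Only the constraints indexed by [D] are imposed: all of them give the
polyhedron, those active at a point give its tangent cone there. *)
Definition solution_set m (a : 'I_m -> 'rV[R]_n) (b : 'I_m -> R) (D : set 'I_m)
    : set 'rV[R]_n := [set x | forall k, D k -> dot (a k) x <= b k].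

Lemma convex_polyhedronE P : convex_polyhedron P ->
  exists m (a : 'I_m -> 'rV[R]_n) b, P = solution_set a b setT.
Proof.
move=> [m [H [Hhs ->]]].
have Hrepr k : exists ab : 'rV[R]_n * R, H k = [set x | dot ab.1 x <= ab.2].
  by have [a [b [_ ->]]] := Hhs k; exists (a, b).
have [ab abP] := choice Hrepr.
exists m, (fun k => (ab k).1), (fun k => (ab k).2).
by apply/seteqP; split=> x xH k kT; have := xH k kT; rewrite abP.
Qed.

Lemma closed_solution_set m (a : 'I_m -> 'rV[R]_n) b D :
  closed (solution_set a b D).
Proof.
rewrite (_ : solution_set a b D =
  \bigcap_(k in D) dot (a k) @^-1` [set t | t <= b k]) //.
apply: closed_bigI => k _; apply: preimage_closed => [x _|].
  exact: dot_continuous.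
exact: closed_le.
Qed.

Lemma convex_solution_set m (a : 'I_m -> 'rV[R]_n) b D :
  convex (solution_set a b D).
Proof.
move=> x y s Px Py /andP[s0 s1] k Dk.
rewrite [x + _]/(homothety x s y) dot_homothety.
have := Px k Dk; have := Py k Dk; nra.
Qed.

(** Active constraints at [p] are preserved by homotheties centered at [p].
Conversely, if [x] satisfies them, then shrinking [x] towards [p] eventually
satisfies the inactive ones, which have positive slack at [p]; finitely many
constraints allow a common factor. *)
Lemma tangent_cone_solution_set m (a : 'I_m -> 'rV[R]_n) b p
    (P := solution_set a b setT) :
  P p -> tangent_cone P p = solution_set a b [set k | dot (a k) p = b k].
Proof.
move=> Pp; apply/seteqP; split=> x.
  move=> /tangent_coneP[l [y Py <-]] k /= kact; rewrite dot_homothety kact.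
  have := Py k I; have : 0 <= l%:R :> R by rewrite ler0n.
  nra.
move=> xP; apply/tangent_coneP.
(* Dividing [x - p] by more than [N k] keeps the increase of the [k]-th
   constraint below its slack. *)
pose N k := Num.bound `|(dot (a k) x - dot (a k) p) / (b k - dot (a k) p)|.
pose l := (\max_k N k).+1.
have l0 : 0 < l%:R :> R by rewrite ltr0n.
exists l, (homothety p l%:R^-1 x); last first.
  rewrite /homothety addrAC subrr add0r scalerA divff ?gt_eqF// scale1r.
  by rewrite addrC subrK.
move=> k _; rewrite dot_homothety -lerBrDl mulrC ler_pdivrMr//.
have [kact|kinact] := eqVneq (dot (a k) p) (b k).
  by rewrite kact subrr mul0r subr_le0; apply: xP.
have d0 : 0 < b k - dot (a k) p.
  by rewrite subr_gt0 lt_neqAle kinact; apply: Pp.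
rewrite mulrC -ler_pdivrMr//; apply: ltW.
apply: le_lt_trans (ler_norm _) _.
apply: lt_le_trans (archi_boundP (normr_ge0 _)) _; rewrite ler_nat.
exact: leqW (leq_bigmax k).
Qed.

End MaxNorm.

Theorem theorem1p1 (R : realType) (n : nat) (P : set 'rV[R]_n)
    (polyP : convex_polyhedron P) (intP : P° !=set0) :
  injective_space (set_type P) <->
  (forall p : 'rV[R]_n, boundary P p ->
     injective_space (set_type (tangent_cone P p))).
Proof.
have [m [a [b PE]]] := convex_polyhedronE polyP.
have clP : closed P by rewrite PE; exact: closed_solution_set.
have cvxP : convex P by rewrite PE; exact: convex_solution_set.
rewrite injective_hyperconvexP; split=> [hP p|hT].
  rewrite /boundary -(closure_id P).1// => -[Pp _].
  apply/injective_hyperconvexP; apply: hyperconvex_tangent_cone => //.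
  by move: Pp; rewrite PE => Pp; rewrite tangent_cone_solution_set//;
    exact: closed_solution_set.
apply: hyperconvex_of_tangent_cones => // [|p Pp].
  by have [p /interior_subset Pp] := intP; exists p.
have [intp|Nintp] := pselect (P° p).
  by rewrite tangent_cone_interior//; exact: hyperconvex_setT.
apply/injective_hyperconvexP; apply: hT; split=> //.
exact: subset_closure.
Qed.
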